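(* Let $r=r(A)$ be the rank of $A$ and let $\mu>0$. Suppose that there exist an index $s$ with $1\le s\le r$ and a number $\delta\in(0,1]$ such that $$d_s(XA)>(1+\delta)\sqrt{\mu}\quad\text{and}\quad d_{s+1}(XA)<(1-\delta)\sqrt{\mu}.$$ Then $$\mathbb{P}\{\hat k=s\}\ \ge\ 1-\mathbb{P}\{d_1(PE)\ge\delta\sqrt{\mu}\}.$$
   Context: Multivariate response regression model: $Y=XA+E$, where $Y$ is the $m\times n$ response matrix, $X$ is a fixed (nonrandom) $m\times p$ matrix, $A$ is an unknown fixed $p\times n$ matrix, and $E$ is a random $m\times n$ matrix with independent entries of mean zero and variance $\sigma^2$. $P$ is the orthogonal projection matrix in $\mathbb{R}^m$ onto the column space of $X$. For a matrix $C$, $r(C)$ is its rank, $\|C\|_F$ its Frobenius norm, and $d_1(C)\ge d_2(C)\ge\cdots$ its singular values in decreasing order ($d_j(C)=0$ for $j$ larger than the rank of $C$). The Rank Selection Criterion (RSC) estimator with tuning parameter $\mu>0$ is a minimizer $\hat A$ of $\|Y-XB\|_F^2+\mu\, r(B)$ over all $p\times n$ matrices $B$, and $\hat k=r(\hat A)$; equivalently, $\hat k=\max\{k: d_k(PY)\ge\sqrt{\mu}\}$, the number of singular values of $PY$ that are at least $\sqrt\mu$ ($\hat k=0$ if there are none; if the minimizer is not unique, $\hat A$ is taken to be a minimizer with this rank). *)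

(* Defs.v *)
From HB Require Import structures.
From mathcomp Require Import all_boot all_order all_algebra.
From mathcomp Require Import polyrcf.
From mathcomp Require Import all_classical all_reals all_analysis.

Set Implicit Arguments.
Unset Strict Implicit.
Unset Printing Implicit Defensive.

Import Order.TTheory GRing.Theory Num.Theory.
Local Open Scope classical_set_scope.
Local Open Scope ring_scope.

(* The square roots of the eigenvalues of C^T C, each repeated according to its
   multiplicity as a root of the characteristic polynomial, in decreasing
   order. *)
Definition singular_values (R : rcfType) (m n : nat) (C : 'M[R]_(m, n)) : seq R :=
  let p := char_poly (C^T *m C) in
  sort >=%R (flatten [seq nseq (mup x p) (Num.sqrt x) | x <- rootsR p]).

(* d_j(C), numbered from j = 1 (the junk value at j = 0 is d_1(C)); it is 0
   beyond the end of the list. *)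
Definition sing_val (R : rcfType) (m n : nat) (C : 'M[R]_(m, n)) (j : nat) : R :=
  (singular_values C)`_j.-1.

Definition frobenius (R : rcfType) (m n : nat) (C : 'M[R]_(m, n)) : R :=
  Num.sqrt (\sum_i \sum_j C i j ^+ 2).

(* Subspaces of MathComp matrices are row spaces and proj_mx acts on row
   vectors on the right, hence the transpositions. The row space of X^T is the
   column space of X, and kermx X is its orthogonal complement: it consists of
   the row vectors u such that u *m X = 0. *)
Definition col_proj (R : fieldType) (m p : nat) (X : 'M[R]_(m, p)) : 'M[R]_m :=
  (proj_mx <<X^T>>%MS (kermx X))^T.

Definition rsc_criterion (R : rcfType) (m p n : nat) (mu : R)
    (X : 'M[R]_(m, p)) (Y : 'M[R]_(m, n)) (B : 'M[R]_(p, n)) : R :=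
  frobenius (Y - X *m B) ^+ 2 + mu * (\rank B)%:R.

Definition rsc_minimizer (R : rcfType) (m p n : nat) (mu : R)
    (X : 'M[R]_(m, p)) (Y : 'M[R]_(m, n)) (B : 'M[R]_(p, n)) : Prop :=
  forall B' : 'M[R]_(p, n), rsc_criterion mu X Y B <= rsc_criterion mu X Y B'.

(* max {k : d_k(PY) >= sqrt mu}, or 0 if there is no such k; for mu > 0 every
   such k is at most n, since d_k(PY) = 0 for k > n. *)
Definition rsc_rank (R : rcfType) (m p n : nat) (mu : R)
    (X : 'M[R]_(m, p)) (Y : 'M[R]_(m, n)) : nat :=
  \max_(k < n.+1 | (0 < k)%N && (Num.sqrt mu <= sing_val (col_proj X *m Y) k)) k.

(* The prescription of the rank is a tie-breaking rule: it is only imposed when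
   the minimizer is not unique. *)
Definition rsc_estimate (R : rcfType) (m p n : nat) (mu : R)
    (X : 'M[R]_(m, p)) (Y : 'M[R]_(m, n)) (Ahat : 'M[R]_(p, n)) : Prop :=
  rsc_minimizer mu X Y Ahat /\
  ((exists2 B, rsc_minimizer mu X Y B & B <> Ahat) ->
   \rank Ahat = rsc_rank mu X Y).

Definition mutually_independent (d : measure_display) (T : measurableType d)
    (R : realType) (P : probability T R) (I : finType)
    (Z : I -> {RV P >-> R}) : Prop :=
  forall (J : {set I}) (B : I -> set R), (forall i, measurable (B i)) ->
    P [set w | forall i, i \in J -> B i (Z i w)] =
    (\prod_(i in J) P (Z i @^-1` B i))%E.

Definition rv_matrix (d : measure_display) (T : measurableType d)
    (R : realType) (P : probability T R) (m n : nat)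
    (E : 'I_m -> 'I_n -> {RV P >-> R}) (w : T) : 'M[R]_(m, n) :=
  \matrix_(i, j) E i j w.

(* Main.v *)
(* Weyl's inequality d_(i+j-1)(A + B) <= d_i(A) + d_j(B), obtained by intersecting
   spectral subspaces, makes every singular value 1-Lipschitz for d_1. Since
   PY - XA = PE, on the event d_1(PE) < delta sqrt(mu) exactly s singular values
   of PY are at least sqrt(mu). Weyl's inequality also yields the Eckart-Young
   bound, by which the criterion at B is at least a constant plus
   sum_(i > k) d_i(PY)^2 + mu k with k = r(B). This lower bound is minimal, and
   attained, at k = #{i : d_i(PY) >= sqrt(mu)}; hence r(Ahat) is always that
   number, whether or not the minimizer is unique. In particular {r(Ahat) = s} is
   measurable, even though Ahat need not be, and the inclusion of events passes
   to probabilities. *)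

Require Import Defs.
From HB Require Import structures.
From mathcomp Require Import all_boot all_order all_fingroup all_algebra.
From mathcomp Require Import ring lra zify.
From mathcomp Require Import polyrcf complex.
From mathcomp Require Import all_classical all_reals all_analysis.
From mathcomp Require Import measurable_realfun.

Set Implicit Arguments.
Unset Strict Implicit.
Unset Printing Implicit Defensive.

Import Order.TTheory GRing.Theory Num.Theory.
Local Open Scope classical_set_scope.
Local Open Scope ring_scope.

(** * The spectral theorem for real symmetric matrices *)

Definition sqnorm (R : pzRingType) (n : nat) (u : 'rV[R]_n) : R := (u *m u^T) 0 0.

Lemma sqnormE (R : pzRingType) (n : nat) (u : 'rV[R]_n) :
  sqnorm u = \sum_i u 0 i * u 0 i.
Proof. by rewrite /sqnorm mxE; apply: eq_bigr => i _; rewrite mxE. Qed.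

Lemma sqnorm_ge0 (R : realDomainType) (n : nat) (u : 'rV[R]_n) : 0 <= sqnorm u.
Proof. by rewrite sqnormE sumr_ge0 // => i _; rewrite -expr2 sqr_ge0. Qed.

Lemma sqnorm_eq0 (R : realDomainType) (n : nat) (u : 'rV[R]_n) :
  (sqnorm u == 0) = (u == 0).
Proof.
apply/idP/eqP => [|->]; last by rewrite sqnormE big1 // => i _; rewrite mxE mul0r.
rewrite sqnormE psumr_eq0 => [/allP u0|i _]; last by rewrite -expr2 sqr_ge0.
apply/rowP => i; rewrite mxE.
by have := u0 i (mem_index_enum i); rewrite mulf_eq0 orbb => /eqP.
Qed.

Lemma sqnorm_gt0 (R : realDomainType) (n : nat) (u : 'rV[R]_n) :
  (0 < sqnorm u) = (u != 0).
Proof. by rewrite lt_def sqnorm_ge0 andbT sqnorm_eq0. Qed.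

Lemma sqnormZ (R : comPzRingType) (n : nat) (a : R) (u : 'rV[R]_n) :
  sqnorm (a *: u) = a ^+ 2 * sqnorm u.
Proof. by rewrite /sqnorm linearZ /= -scalemxAl -scalemxAr scalerA mxE expr2. Qed.

(* An eigenvalue of [S] over [R[i]] is real because [S] is Hermitian there. *)
Lemma symmetric_eigenvalue (R : rcfType) (n : nat) (S : 'M[R]_n.+1) :
  S^T = S -> exists a, eigenvalue S a.
Proof.
move=> symS.
pose f := complex.real_complex R : R -> complex.complex R.
pose Sc := map_mx f S.
have [a eig_a] := eigenvalue_closed Sc (ltn0Sn n).
have [v vS v_neq0] := eigenvalueP eig_a.
have conjSc : map_mx Num.conj Sc = Sc.
  by apply/matrixP => i j; rewrite !mxE; exact: complex.conjc_real.
have symSc : Sc^T = Sc by rewrite /Sc map_trmx symS.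
(* Transposing and conjugating [vS] makes [w] a column eigenvector for the conjugate of [a].
   Computing [v *m Sc *m w] from either side then equates the two eigenvalues, because the scalar
   [v *m w] is nonzero. *)
pose w : 'cV_n.+1 := (map_mx Num.conj v)^T.
have Sw : Sc *m w = a^* *: w.
  rewrite -[X in X *m _]trmxK symSc -trmx_mul -[X in _ *m X]conjSc -map_mxM vS.
  by rewrite map_mxZ linearZ.
have vw_neq0 : (v *m w) 0 0 != 0.
  have vwE : (v *m w) 0 0 = \sum_i `|v 0 i| ^+ 2.
    by rewrite mxE; apply: eq_bigr => i _; rewrite !mxE normCK.
  rewrite vwE psumr_eq0 => [|i _]; last exact: exprn_ge0.
  apply: contra v_neq0 => /allP v0; apply/eqP/rowP => i; rewrite mxE.
  by have := v0 i (mem_index_enum i); rewrite expf_eq0 normr_eq0 => /eqP.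
have a_real : a^* = a.
  have : a *: (v *m w) = a^* *: (v *m w).
    by rewrite scalemxAl -vS -mulmxA Sw -scalemxAr.
  by move/matrixP/(_ 0 0); rewrite !(mxE scalemx_key) => /(mulIf vw_neq0).
have /complex.complex_realP [b aE] : a \is Num.real by apply/CrealP.
exists b; rewrite -(eigenvalue_map (complex.real_complex R)).
by move: eig_a; rewrite aE.
Qed.

Lemma orthogonal_with_row0 (R : rcfType) (n : nat) (v : 'rV[R]_n.+1) :
  sqnorm v = 1 ->
  exists H : 'M[R]_n.+1, [/\ H^T = H, H *m H = 1%:M & delta_mx 0 0 *m H = v].
Proof.
(* [H] is the Householder reflection exchanging [v] and the first basis vector. *)
move=> v1; pose e : 'rV[R]_n.+1 := delta_mx 0 0.
have [->|e_neq_v] := eqVneq v e.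
  by exists 1%:M; rewrite trmx1 !mulmx1.
pose w := e - v; pose c := sqnorm w.
have c_neq0 : c != 0 by rewrite /c sqnorm_eq0 subr_eq0 eq_sym.
have wwE : w *m w^T = c%:M by rewrite [LHS]mx11_scalar.
have evE : e *m v^T = (v 0 0)%:M.
  by rewrite [LHS]mx11_scalar -rowE !mxE.
have veE : v *m e^T = (v 0 0)%:M by rewrite -[LHS]trmxK trmx_mul trmxK evE tr_scalar_mx.
have eeE : e *m e^T = 1%:M by rewrite [LHS]mx11_scalar -rowE !mxE !eqxx.
have vvE : v *m v^T = 1%:M by rewrite [LHS]mx11_scalar -[_ 0 0]/(sqnorm v) v1.
have cE : c = 2 * (1 - v 0 0).
  rewrite /c /sqnorm /w [_^T]linearB /= mulmxBl !mulmxBr evE veE eeE vvE !mxE !eqxx.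
  by rewrite !mulr1n; ring.
have ewE : e *m w^T = (1 - v 0 0)%:M.
  by rewrite /w [_^T]linearB /= mulmxBr evE eeE -raddfB.
have wE : w = e - v by [].
clearbody w c.
exists (1%:M - (2 / c) *: (w^T *m w)); split.
- by rewrite [_^T]linearB /= trmx1 linearZ /= trmx_mul trmxK.
- rewrite mulmxBl mul1mx mulmxBr mulmx1 -scalemxAl -scalemxAr scalerA.
  rewrite mulmxA -(mulmxA _ w) wwE mul_mx_scalar -scalemxAl scalerA.
  rewrite -scalerBl -[RHS]addr0 -addrA -opprD -scalerDl; congr (_ + _).
  rewrite (_ : 2 / c + _ = 0) ?scale0r ?oppr0 //.
  by field.
- rewrite mulmxBr mulmx1 -scalemxAr mulmxA ewE mul_scalar_mx scalerA.
  rewrite cE (_ : 2 / _ * _ = 1) ?scale1r ?wE ?subKr //.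
  by move: c_neq0; rewrite cE mulf_eq0 pnatr_eq0 /= => v00_neq1; field.
Qed.

(** Induction on the size: a reflection [H] taking the first basis vector to a unit eigenvector
    splits a 1 by 1 block off [H *m S *m H], and the induction hypothesis diagonalizes the remaining
    block. *)
Theorem symmetric_spectral (R : rcfType) (n : nat) (S : 'M[R]_n) :
  S^T = S -> exists (Q : 'M[R]_n) (d : 'rV[R]_n),
    Q *m Q^T = 1%:M /\ S = Q^T *m diag_mx d *m Q.
Proof.
elim: n S => [|n IHn] S symS.
  by exists 1%:M, 0; split; apply/matrixP => -[].
have [a /eigenvalueP[v0 v0S v0_neq0]] := symmetric_eigenvalue symS.
have v0_gt0 : 0 < sqnorm v0 by rewrite sqnorm_gt0.
pose v := (Num.sqrt (sqnorm v0))^-1 *: v0.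
have v1 : sqnorm v = 1.
  by rewrite sqnormZ exprVn sqr_sqrtr ?ltW // mulVf // gt_eqF.
have vS : v *m S = a *: v by rewrite -scalemxAl v0S scalerA mulrC -scalerA.
have [H [symH HH Hv]] := orthogonal_with_row0 v1.
pose M : 'M[R]_(1 + n) := H *m S *m H.
have symM : M^T = M by rewrite !trmx_mul symS symH mulmxA.
(* [H] is an involution, so it also sends [v] back to the first basis vector, which is therefore an
   eigenvector of [M]. Symmetry of [M] will clear the first column as well. *)
have M0 j : M (lshift n 0) j = a *+ (j == lshift n 0).
  have /rowP/(_ j) : row (lshift n 0) M = a *: delta_mx 0 (lshift n 0).
    rewrite (_ : lshift n 0 = 0); last exact: val_inj.
    rewrite rowE !mulmxA Hv vS -scalemxAl; congr (_ *: _).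
    by rewrite -Hv -mulmxA HH mulmx1.
  by rewrite mxE => ->; rewrite !mxE eqxx /= mulr_natr.
have MH : H *m M *m H = S.
  by rewrite -[RHS]mulmx1 -[RHS]mul1mx -HH !mulmxA.
clearbody M.
have ursubM : ursubmx M = 0.
  by apply/matrixP => i j; rewrite !mxE ord1 M0.
have ulsubM : ulsubmx M = a%:M.
  by apply/matrixP => i j; rewrite !mxE !ord1 M0 !eqxx.
have dlsubM : dlsubmx M = 0 by rewrite -[LHS]trmxK trmx_dlsub symM ursubM trmx0.
have [|Q [d [QQ drE]]] := IHn (drsubmx M); first by rewrite trmx_drsub symM.
pose Q1 : 'M[R]_(1 + n) := block_mx 1%:M 0 0 Q.
have ME : M = Q1^T *m diag_mx (row_mx a%:M d) *m Q1.
  rewrite -[LHS]submxK ulsubM ursubM dlsubM drE diag_mx_row tr_block_mx !mulmx_block.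
  rewrite !trmx0 trmx1 !(mul0mx, mulmx0, mul1mx, mulmx1, addr0, add0r).
  by congr block_mx; apply/matrixP => i j; rewrite !ord1 !mxE eqxx mulr1n.
have QQ1 : Q1 *m Q1^T = 1%:M.
  rewrite tr_block_mx mulmx_block !trmx0 trmx1 QQ.
  by rewrite !(mul0mx, mulmx0, mul1mx, addr0, add0r) -scalar_mx_block.
clearbody Q1; exists (Q1 *m H), (row_mx a%:M d); split.
  by rewrite trmx_mul symH mulmxA -(mulmxA Q1) HH mulmx1.
by rewrite -MH ME trmx_mul symH !mulmxA.
Qed.

(** * Singular values *)

(** Conjugation by [Q], lifted to constant polynomials, fixes ['X%:M] and preserves the determinant,
    which leaves the diagonal case. *)
Lemma char_poly_spectral (R : comNzRingType) (n : nat) (Q : 'M[R]_n) (d : 'rV[R]_n) :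
  Q *m Q^T = 1%:M ->
  char_poly (Q^T *m diag_mx d *m Q) =
    \prod_(x <- [seq d 0 i | i <- enum 'I_n]) ('X - x%:P).
Proof.
move=> QQ; have QQ' := mulmx1C QQ.
pose q := map_mx polyC Q.
have qq : q^T *m q = 1%:M by rewrite /q map_trmx -map_mxM QQ' map_mx1.
transitivity (char_poly (diag_mx d)).
  rewrite /char_poly /char_poly_mx !map_mxM -map_trmx -/q.
  set D := map_mx _ (diag_mx d).
  rewrite (_ : 'X%:M - _ = q^T *m ('X%:M - D) *m q); last first.
    by rewrite mulmxBr mulmxBl mul_mx_scalar -scalemxAl qq scalemx1.
  by rewrite !det_mulmx mulrC mulrA -det_mulmx mulmx1C // det1 mul1r.
rewrite char_poly_trig ?diag_mx_is_trig // big_map big_enum /=.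
by apply: eq_bigr => i _; rewrite mxE eqxx.
Qed.

(** Bridge to the definition of [singular_values]: for a split polynomial, the multiplicity of a
    root is its number of occurrences in [s]. *)
Lemma perm_rootsR_prod (R : rcfType) (T : eqType) (f : R -> T) (s : seq R) :
  perm_eq (flatten [seq nseq (mup x (\prod_(y <- s) ('X - y%:P))) (f x) |
                    x <- rootsR (\prod_(y <- s) ('X - y%:P))]) (map f s).
Proof.
set p := \prod_(y <- s) _; have p_neq0 : p != 0.
  by rewrite monic_neq0 // monic_prod // => x _; exact: monicXsubC.
have -> : flatten [seq nseq (mup x p) (f x) | x <- rootsR p] =
    map f (flatten [seq nseq (count_mem x s) x | x <- rootsR p]).
  rewrite map_flatten; congr flatten; rewrite -map_comp; apply: eq_map => x /=.
  by rewrite map_nseq mu_prod_XsubC.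
apply: perm_map; apply: perm_trans (perm_count_undup s).
apply/perm_flatten/perm_map; apply: uniq_perm; rewrite ?undup_uniq ?uniq_roots //.
move=> x; rewrite mem_undup -(roots_on_rootsR p_neq0) in_itv /=.
by rewrite root_prod_XsubC.
Qed.

Lemma sqnorm_mul_tr (R : comPzRingType) (m n : nat) (C : 'M[R]_(m, n)) (u : 'rV[R]_n) :
  sqnorm (u *m C^T) = (u *m (C^T *m C) *m u^T) 0 0.
Proof. by rewrite /sqnorm trmx_mul trmxK !mulmxA. Qed.

Lemma quad_spectral (R : comPzRingType) (n : nat) (Q : 'M[R]_n) (d u : 'rV[R]_n) :
  (u *m (Q^T *m diag_mx d *m Q) *m u^T) 0 0 =
  \sum_i d 0 i * (u *m Q^T) 0 i ^+ 2.
Proof.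
have -> : u *m (Q^T *m diag_mx d *m Q) *m u^T = u *m Q^T *m diag_mx d *m (u *m Q^T)^T.
  by rewrite trmx_mul trmxK !mulmxA.
rewrite mxE; apply: eq_bigr => i _.
by rewrite mul_mx_diag [X in X * _]mxE [X in _ * X]mxE mulrAC mulrC -expr2.
Qed.

Lemma gram_spectral (R : rcfType) (m n : nat) (C : 'M[R]_(m, n)) :
  exists (Q : 'M[R]_n) (d : 'rV[R]_n),
    [/\ Q *m Q^T = 1%:M, C^T *m C = Q^T *m diag_mx d *m Q, forall i, 0 <= d 0 i
      & perm_eq (singular_values C) [seq Num.sqrt (d 0 i) | i <- enum 'I_n]].
Proof.
have symS : (C^T *m C)^T = C^T *m C by rewrite trmx_mul trmxK.
have [Q [d [QQ SE]]] := symmetric_spectral symS.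
exists Q, d; split=> // [i|].
  (* The eigenvalue [d 0 i] is the Gram quadratic form at the [i]-th row of [Q], hence a squared
     norm. *)
  have := sqnorm_ge0 (row i Q *m C^T); rewrite sqnorm_mul_tr SE quad_spectral.
  rewrite -row_mul QQ (bigD1 i) //= big1 ?addr0 => [|j j_neq_i].
    by rewrite !mxE eqxx expr1n mulr1.
  by rewrite !mxE eq_sym (negPf j_neq_i) expr0n mulr0.
rewrite /singular_values SE char_poly_spectral // perm_sort.
rewrite [X in perm_eq _ X](map_comp Num.sqrt (fun i => d 0 i)).
exact: perm_rootsR_prod.
Qed.

Lemma size_singular_values (R : rcfType) (m n : nat) (C : 'M[R]_(m, n)) :
  size (singular_values C) = n.
Proof.
have [Q [d [_ _ _ /perm_size->]]] := gram_spectral C.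
by rewrite size_map size_enum_ord.
Qed.

Lemma sing_val_default (R : rcfType) (m n : nat) (C : 'M[R]_(m, n)) (i : nat) :
  (n <= i)%N -> sing_val C i.+1 = 0.
Proof. by move=> le_ni; rewrite /sing_val nth_default // size_singular_values. Qed.

Lemma sing_val_ge0 (R : rcfType) (m n : nat) (C : 'M[R]_(m, n)) (i : nat) :
  0 <= sing_val C i.
Proof.
rewrite /sing_val.
have [lt_in|/(nth_default _)->//] := ltnP i.-1 (size (singular_values C)).
have [Q [d [_ _ _ /perm_mem eqs]]] := gram_spectral C.
by have := mem_nth 0 lt_in; rewrite eqs => /mapP[j _ ->]; exact: sqrtr_ge0.
Qed.

Lemma sing_val_decreasing (R : rcfType) (m n : nat) (C : 'M[R]_(m, n)) (i j : nat) :
  (i <= j)%N -> sing_val C j.+1 <= sing_val C i.+1.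
Proof.
move=> le_ij; have [lt_jn|le_nj] := ltnP j n; last first.
  by rewrite sing_val_default ?sing_val_ge0.
have ge_trans : transitive (>=%R : rel R) by move=> y x z /[swap]; exact: le_trans.
have ge_total : total (>=%R : rel R) by move=> x y; exact: le_total.
have sv_sorted : sorted >=%R (singular_values C) by exact: sort_sorted.
apply: (sorted_leq_nth ge_trans (lexx : reflexive >=%R) 0 sv_sorted) => //=;
  by rewrite inE size_singular_values //; exact: leq_ltn_trans lt_jn.
Qed.

(** Permuting the rows of [Q] puts the eigenvalues in the order of the sorted list, so that the rows
    of index below [k] belong to the [k] largest ones. *)
Lemma sing_val_spectral (R : rcfType) (m n : nat) (C : 'M[R]_(m, n)) :
  exists2 Q : 'M[R]_n, Q *m Q^T = 1%:M &
    C^T *m C = Q^T *m diag_mx (\row_(i < n) sing_val C i.+1 ^+ 2) *m Q.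
Proof.
have [Q [d [QQ SE d_ge0 eqs]]] := gram_spectral C.
have sz : size [seq Num.sqrt (d 0 i) | i <- enum 'I_n] == n.
  by rewrite size_map size_enum_ord.
have [s sE] := tuple_permP (eqs : perm_eq _ (Tuple sz)).
have svE (i : 'I_n) : sing_val C i.+1 ^+ 2 = d 0 (s i) :> R.
  rewrite /sing_val sE /=.
  rewrite (nth_map i) ?size_enum_ord // nth_ord_enum (tnth_nth 0) /=.
  by rewrite (nth_map i) ?size_enum_ord // nth_ord_enum sqr_sqrtr.
exists (row_perm s Q).
  rewrite row_permE trmx_mul mulmxA -(mulmxA _ Q) QQ mulmx1 tr_perm_mx -perm_mxM.
  by rewrite mulgV perm_mx1.
rewrite SE; apply/matrixP => i j; rewrite !mxE (reindex_perm s) /=.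
by apply: eq_bigr => k _; rewrite !mul_mx_diag !mxE svE.
Qed.

(** * Spectral subspaces and Weyl's inequality *)

Lemma sqnormD_le (R : realFieldType) (n : nat) (u v : 'rV[R]_n) (x y : R) :
  0 <= x -> 0 <= y -> sqnorm u <= x ^+ 2 -> sqnorm v <= y ^+ 2 ->
  sqnorm (u + v) <= (x + y) ^+ 2.
Proof.
move=> x_ge0 y_ge0 ux vy.
have [x0|x_neq0] := eqVneq x 0.
  move: ux; rewrite x0 expr0n /= => u_le0.
  have /eqP : sqnorm u == 0 by rewrite eq_le u_le0 sqnorm_ge0.
  by move/eqP; rewrite sqnorm_eq0 => /eqP->; rewrite !add0r.
have [y0|y_neq0] := eqVneq y 0.
  move: vy; rewrite y0 expr0n /= => v_le0.
  have /eqP : sqnorm v == 0 by rewrite eq_le v_le0 sqnorm_ge0.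
  by move/eqP; rewrite sqnorm_eq0 => /eqP->; rewrite !addr0.
pose c := \sum_i u 0 i * v 0 i.
have lin a b : sqnorm (a *: u + b *: v) =
    a ^+ 2 * sqnorm u + 2 * a * b * c + b ^+ 2 * sqnorm v.
  rewrite !sqnormE /c !mulr_sumr -!big_split; apply: eq_bigr => i _ /=.
  by rewrite !mxE; ring.
have xy_gt0 : 0 < x * y by rewrite mulr_gt0 // lt_def ?x_neq0 ?y_neq0.
(* Cauchy-Schwarz, from the nonnegative squared norm of [y *: u - x *: v]. Cancelling [x * y] is why
   the zero cases were treated first. *)
have c_le : c <= x * y.
  have := sqnorm_ge0 (y *: u + (- x) *: v); rewrite lin => ge0.
  rewrite -(ler_pM2l xy_gt0).
  have : y ^+ 2 * sqnorm u <= y ^+ 2 * x ^+ 2 by rewrite ler_wpM2l ?sqr_ge0.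
  have : x ^+ 2 * sqnorm v <= x ^+ 2 * y ^+ 2 by rewrite ler_wpM2l ?sqr_ge0.
  by move: ge0; rewrite sqrrN; lra.
have := lin 1 1; rewrite !scale1r => ->.
by rewrite expr1n !mul1r mulr1 sqrrD; lra.
Qed.

Lemma mul_mx_pid (R : pzSemiRingType) (m n k : nat) (A : 'M[R]_(m, n)) i (j : 'I_n) :
  (A *m (pid_mx k : 'M[R]_n)) i j = if (j < k)%N then A i j else 0.
Proof.
rewrite mxE (bigD1 j) //= big1 ?addr0 => [|l l_neq_j].
  by rewrite mxE eqxx /=; case: ifP; rewrite ?mulr1 ?mulr0.
by rewrite mxE -[X in X && _]/(l == j) (negPf l_neq_j) mulr0.
Qed.

Lemma mul_mx_copid (R : pzRingType) (m n k : nat) (A : 'M[R]_(m, n)) i (j : 'I_n) :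
  (A *m (copid_mx k : 'M[R]_n)) i j = if (j < k)%N then 0 else A i j.
Proof.
rewrite mulmxBr mulmx1 [LHS]mxE [X in _ + X]mxE mul_mx_pid.
by case: ifP; rewrite ?subrr ?subr0.
Qed.

Lemma sqnorm_orthogonal (R : comPzRingType) (n : nat) (Q : 'M[R]_n) (u : 'rV[R]_n) :
  Q^T *m Q = 1%:M -> sqnorm (u *m Q^T) = sqnorm u.
Proof. by move=> QQ; rewrite /sqnorm trmx_mul trmxK mulmxA -(mulmxA u) QQ mulmx1. Qed.

(** [W] is spanned by the first [k.+1] rows of [Q]: in these coordinates only eigenvalues at least
    [sing_val C k.+1 ^+ 2] contribute to the quadratic form. *)
Lemma sing_val_top (R : rcfType) (m n : nat) (C : 'M[R]_(m, n)) (k : nat) :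
  (k < n)%N -> exists2 W : 'M[R]_n, \rank W = k.+1 &
    forall u : 'rV[R]_n, (u <= W)%MS ->
      sing_val C k.+1 ^+ 2 * sqnorm u <= sqnorm (u *m C^T).
Proof.
move=> lt_kn; have [Q QQ SE] := sing_val_spectral C; have QQ' := mulmx1C QQ.
have Q_free : row_free Q by apply/row_freeP; exists Q^T.
exists (pid_mx k.+1 *m Q); first by rewrite mxrankMfree // rank_pid_mx.
move=> u /submxP[x uE].
have yE : u *m Q^T = x *m pid_mx k.+1 by rewrite uE -!mulmxA QQ mulmx1.
rewrite sqnorm_mul_tr SE quad_spectral -(sqnorm_orthogonal u QQ') sqnormE yE mulr_sumr.
apply: ler_sum => i _; rewrite mul_mx_pid ltnS mxE -expr2.
case: leqP => [le_ik|_]; last by rewrite expr0n !mulr0.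
rewrite ler_wpM2r ?sqr_ge0 // lerXn2r ?nnegrE ?sing_val_ge0 //.
exact: sing_val_decreasing.
Qed.

(** Dually, [W] is spanned by the last [n - k] rows of [Q]. *)
Lemma sing_val_bottom (R : rcfType) (m n : nat) (C : 'M[R]_(m, n)) (k : nat) :
  (k <= n)%N -> exists2 W : 'M[R]_n, \rank W = (n - k)%N &
    forall u : 'rV[R]_n, (u <= W)%MS ->
      sqnorm (u *m C^T) <= sing_val C k.+1 ^+ 2 * sqnorm u.
Proof.
move=> le_kn; have [Q QQ SE] := sing_val_spectral C; have QQ' := mulmx1C QQ.
have Q_free : row_free Q by apply/row_freeP; exists Q^T.
exists (copid_mx k *m Q); first by rewrite mxrankMfree // rank_copid_mx.
move=> u /submxP[x uE].
have yE : u *m Q^T = x *m copid_mx k by rewrite uE -!mulmxA QQ mulmx1.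
rewrite sqnorm_mul_tr SE quad_spectral -(sqnorm_orthogonal u QQ') sqnormE yE mulr_sumr.
apply: ler_sum => i _; rewrite mul_mx_copid mxE -expr2.
case: ltnP => [_|le_ki]; first by rewrite expr0n !mulr0.
rewrite ler_wpM2r ?sqr_ge0 // lerXn2r ?nnegrE ?sing_val_ge0 //.
exact: sing_val_decreasing.
Qed.

Lemma capmx_neq0 (F : fieldType) (m1 m2 n : nat)
    (A : 'M[F]_(m1, n)) (B : 'M[F]_(m2, n)) :
  (n < \rank A + \rank B)%N -> (A :&: B)%MS != 0.
Proof.
rewrite -mxrank_sum_cap -mxrank_eq0 -lt0n => lt_n.
have := leq_trans lt_n (leq_add (rank_leq_col _) (leqnn _)).
by rewrite -[X in (X < _)%N]addn0 ltn_add2l.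
Qed.

(* On a subspace of dimension i + j + 1 the norm of A + B is at least its
   (i + j + 1)-st singular value, and that subspace meets the bottom subspaces
   of A and B, of dimensions n - i and n - j. *)
Lemma sing_valD_le (R : rcfType) (m n : nat) (A B : 'M[R]_(m, n)) (i j : nat) :
  sing_val (A + B) (i + j).+1 <= sing_val A i.+1 + sing_val B j.+1.
Proof.
have [lt_n|le_n] := ltnP (i + j) n; last first.
  by rewrite sing_val_default // addr_ge0 ?sing_val_ge0.
have [W0 rW0 W0P] := sing_val_top (A + B) lt_n.
have [W1 rW1 W1P] := sing_val_bottom A (leq_trans (leq_addr j i) (ltnW lt_n)).
have [W2 rW2 W2P] := sing_val_bottom B (leq_trans (leq_addl i j) (ltnW lt_n)).
have r01 : (j < \rank (W0 :&: W1))%N.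
  have := mxrank_sum_cap W0 W1; rewrite rW0 rW1 => eq_r.
  have := rank_leq_col (W0 + W1)%MS; lia.
have /rowV0Pn[u u_in u_neq0] : (W0 :&: W1 :&: W2)%MS != 0.
  by apply: capmx_neq0; rewrite rW2; lia.
move: u_in; rewrite !sub_capmx => /andP[/andP[uW0 uW1] uW2].
have u_gt0 : 0 < sqnorm u by rewrite sqnorm_gt0.
have := sing_val_ge0 A i.+1; have := sing_val_ge0 B j.+1.
have := W0P u uW0; have := W1P u uW1; have := W2P u uW2.
set a := sing_val A _; set b := sing_val B _; set c := sing_val _ _.
move=> uB uA uAB b_ge0 a_ge0; pose z := Num.sqrt (sqnorm u).
have zE : sqnorm u = z ^+ 2 by rewrite sqr_sqrtr // ltW.
have z_ge0 : 0 <= z by exact: sqrtr_ge0.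
have : sqnorm (u *m (A + B)^T) <= (a * z + b * z) ^+ 2.
  rewrite linearD /= mulmxDr; apply: sqnormD_le; rewrite ?mulr_ge0 //.
    by rewrite exprMn -zE.
  by rewrite exprMn -zE.
move/(le_trans uAB); rewrite -mulrDl exprMn -zE ler_pM2r //.
by rewrite ler_sqr ?nnegrE ?sing_val_ge0 ?addr_ge0.
Qed.

(** By dimension count, the top subspace of dimension [k.+1] contains a nonzero vector killed by
    [M^T], where the lower bound of [sing_val_top] forces the singular value to vanish. *)
Lemma sing_val_rank (R : rcfType) (m n : nat) (M : 'M[R]_(m, n)) (k : nat) :
  (\rank M <= k)%N -> sing_val M k.+1 = 0.
Proof.
move=> le_rk; have [lt_kn|le_nk] := ltnP k n; last by rewrite sing_val_default.
have [W rW WP] := sing_val_top M lt_kn.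
have /rowV0Pn[u u_in u_neq0] : (W :&: kermx M^T)%MS != 0.
  by apply: capmx_neq0; rewrite rW mxrank_ker mxrank_tr; have := rank_leq_col M; lia.
move: u_in; rewrite sub_capmx => /andP[/WP uW /sub_kermxP uM].
move: uW; rewrite uM [X in _ <= X]/sqnorm mul0mx mxE pmulr_lle0 ?sqnorm_gt0 // => le0.
by apply/eqP; rewrite -sqrf_eq0 eq_le le0 sqr_ge0.
Qed.

(** * The Frobenius norm and low-rank approximation *)

Lemma frobenius_trace (R : rcfType) (m n : nat) (C : 'M[R]_(m, n)) :
  frobenius C ^+ 2 = \tr (C^T *m C).
Proof.
rewrite /frobenius sqr_sqrtr; last by do 2!apply: sumr_ge0 => ? _; exact: sqr_ge0.
rewrite exchange_big; apply: eq_bigr => j _; rewrite mxE.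
by apply: eq_bigr => i _; rewrite mxE expr2.
Qed.

Lemma frobenius_sing_val (R : rcfType) (m n : nat) (C : 'M[R]_(m, n)) :
  frobenius C ^+ 2 = \sum_(0 <= i < n) sing_val C i.+1 ^+ 2.
Proof.
have [Q QQ SE] := sing_val_spectral C.
rewrite frobenius_trace SE mxtrace_mulC mulmxA QQ mul1mx mxtrace_diag big_mkord.
by apply: eq_bigr => i _; rewrite mxE.
Qed.

Lemma sing_val1_le_frobenius (R : rcfType) (m n : nat) (C : 'M[R]_(m, n)) :
  sing_val C 1 <= frobenius C.
Proof.
have [n0|n_gt0] := posnP n; first by rewrite sing_val_default ?n0 // sqrtr_ge0.
rewrite -ler_sqr ?nnegrE ?sing_val_ge0 ?sqrtr_ge0 // frobenius_sing_val big_ltn //.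
by rewrite lerDl sumr_ge0 // => i _; exact: sqr_ge0.
Qed.

(** Weyl's inequality for [C = (C - M) + M], with [d_(k+1)(M) = 0], bounds [d_(i+k+1)(C)] by
    [d_(i+1)(C - M)]. Squaring and summing over [i < n - k] gives the bound. *)
Lemma eckart_young (R : rcfType) (m n : nat) (C M : 'M[R]_(m, n)) (k : nat) :
  (\rank M <= k)%N ->
  \sum_(k <= i < n) sing_val C i.+1 ^+ 2 <= frobenius (C - M) ^+ 2.
Proof.
move=> rM; have [lt_kn|le_nk] := ltnP k n; last by rewrite big_geq // sqr_ge0.
rewrite frobenius_sing_val [leRHS](big_cat_nat (n := n - k)) ?leq_subr //=.
apply: ler_wpDr; first by apply: sumr_ge0 => i _; exact: sqr_ge0.
rewrite -{1}(add0n k) big_addn; apply: ler_sum_nat => i _.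
rewrite ler_sqr ?nnegrE ?sing_val_ge0 //.
by have := sing_valD_le (C - M) M i k; rewrite subrK (sing_val_rank rM) addr0.
Qed.

(** [N] projects onto the span of the top [k] eigenvectors of the Gram matrix. Having the
    approximation as a right multiple [C *m N] keeps its columns in the column space of [C], as the
    regression setting requires. *)
Lemma eckart_young_attained (R : rcfType) (m n : nat) (C : 'M[R]_(m, n)) (k : nat) :
  (k <= n)%N -> exists2 N : 'M[R]_n, (\rank N <= k)%N &
    frobenius (C - C *m N) ^+ 2 = \sum_(k <= i < n) sing_val C i.+1 ^+ 2.
Proof.
move=> le_kn; have [Q QQ SE] := sing_val_spectral C; have QQ' := mulmx1C QQ.
exists (Q^T *m pid_mx k *m Q).
  apply: leq_trans (mxrankM_maxl _ _) (leq_trans (mxrankM_maxr _ _) _).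
  by rewrite rank_pid_mx.
have -> : C - C *m (Q^T *m pid_mx k *m Q) = C *m (Q^T *m copid_mx k *m Q).
  by rewrite /copid_mx mulmxBr mulmx1 mulmxBl QQ' mulmxBr mulmx1.
rewrite frobenius_trace trmx_mul mulmxA -(mulmxA _ C^T) SE mxtrace_mulC.
set D := diag_mx _.
have -> : Q^T *m copid_mx k *m Q *m ((Q^T *m copid_mx k *m Q)^T *m (Q^T *m D *m Q)) =
   Q^T *m (copid_mx k *m (copid_mx k)^T *m D *m Q).
  rewrite !trmx_mul trmxK !mulmxA -(mulmxA _ Q) QQ mulmx1 -(mulmxA _ Q) QQ mulmx1.
  by [].
rewrite mxtrace_mulC -!mulmxA QQ mulmx1 mulmxA.
have -> : (copid_mx k)^T = copid_mx k :> 'M[R]_n.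
  by rewrite /copid_mx linearB /= trmx1 tr_pid_mx.
rewrite copid_mx_id // mxtrace_mulC /mxtrace.
under eq_bigr do rewrite mul_mx_copid !mxE eqxx mulr1n.
rewrite -(big_mkord xpredT (fun i => if (i < k)%N then 0 else sing_val C i.+1 ^+ 2)).
rewrite (big_cat_nat (n := k)) //= big_nat_cond.
rewrite big1 ?add0r => [|i /andP[/andP[_ ->]]//].
by apply: eq_big_nat => i /andP[le_ki _]; rewrite ltnNge le_ki.
Qed.

Lemma frobenius_ge0 (R : rcfType) (m n : nat) (C : 'M[R]_(m, n)) : 0 <= frobenius C.
Proof. exact: sqrtr_ge0. Qed.

Lemma frobeniusN (R : rcfType) (m n : nat) (C : 'M[R]_(m, n)) :
  frobenius (- C) = frobenius C.
Proof.
by congr Num.sqrt; do 2!apply: eq_bigr => ? _; rewrite mxE sqrrN.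
Qed.

Lemma sing_valN (R : rcfType) (m n : nat) (C : 'M[R]_(m, n)) (k : nat) :
  sing_val (- C) k = sing_val C k.
Proof. by rewrite /sing_val /singular_values [_^T]linearN /= mulNmx mulmxN opprK. Qed.

(** Weyl's inequality with second index 1. Since [sing_val] only looks at [k.-1], the junk index
    [k = 0] is covered too. *)
Lemma sing_val_lipschitz (R : rcfType) (m n : nat) (C D : 'M[R]_(m, n)) (k : nat) :
  sing_val C k <= sing_val D k + sing_val (C - D) 1.
Proof. by have := sing_valD_le D (C - D) k.-1 0; rewrite addn0 addrC subrK. Qed.

(** A weaker bound, but in a norm given by an explicit formula in the entries; it serves for
    measurability. *)
Lemma sing_val_frobenius (R : rcfType) (m n : nat) (C D : 'M[R]_(m, n)) (k : nat) :
  sing_val C k <= sing_val D k + frobenius (C - D).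
Proof.
by apply: le_trans (sing_val_lipschitz C D k) _; rewrite lerD2l sing_val1_le_frobenius.
Qed.

(** * The rank selection criterion *)

(** If [u = x *m X^T] and [u *m X = 0], then [u *m u^T = u *m X *m x^T = 0], and the form is
    definite over an ordered field. *)
Lemma row_kernel_disjoint (R : realFieldType) (m p : nat) (X : 'M[R]_(m, p)) :
  (<<X^T>> :&: kermx X)%MS = 0.
Proof.
apply/eqP/rowV0P => u; rewrite sub_capmx genmxE => /andP[/submxP[x uE] /sub_kermxP uX].
apply/eqP; rewrite -sqnorm_eq0 /sqnorm {2}uE trmx_mul trmxK mulmxA uX mul0mx.
by rewrite mxE.
Qed.

Lemma col_projP (R : realFieldType) (m p : nat) (X : 'M[R]_(m, p)) :
  [/\ (col_proj X)^T = col_proj X, col_proj X *m X = X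
    & exists Z, col_proj X = X *m Z].
Proof.
rewrite /col_proj; set G := proj_mx _ _.
have full : (1%:M <= <<X^T>> + kermx X)%MS.
  rewrite sub1mx /row_full mxrank_disjoint_sum ?row_kernel_disjoint //.
  by rewrite mxrank_gen mxrank_tr mxrank_ker subnKC ?rank_leq_row.
have /sub_kermxP GX : (1%:M - G <= kermx X)%MS.
  by rewrite -[G]mul1mx; exact: proj_mx_compl_sub.
have /submxP[K GE] : (G <= X^T)%MS.
  by rewrite -[G]mul1mx -(genmxE X^T) proj_mx_sub.
clearbody G.
have GtE : G^T = X *m K^T by rewrite GE trmx_mul trmxK.
(* [1%:M - G] annihilates [X], hence also [G^T = X *m K^T]. The right-hand side being symmetric, so
   is [G]. *)
have GtE' : G^T = G *m G^T.
  by apply/eqP; rewrite -subr_eq0 -{1}[G^T]mul1mx -mulmxBl GtE mulmxA GX mul0mx.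
have symG : G^T = G by have := congr1 trmx GtE'; rewrite trmx_mul trmxK -GtE'.
rewrite symG; split=> //; last by exists K^T; rewrite -GtE symG.
by move/eqP: GX; rewrite mulmxBl mul1mx subr_eq0 => /eqP<-.
Qed.

Lemma frobeniusD_orthogonal (R : rcfType) (m n : nat) (C D : 'M[R]_(m, n)) :
  C^T *m D = 0 -> frobenius (C + D) ^+ 2 = frobenius C ^+ 2 + frobenius D ^+ 2.
Proof.
move=> CD; have DC : D^T *m C = 0 by rewrite -[C]trmxK -trmx_mul CD trmx0.
by rewrite !frobenius_trace [_^T]linearD /= mulmxDl !mulmxDr CD DC addr0 add0r raddfD.
Qed.

Section RankSelection.
Variables (R : rcfType) (m p n : nat) (mu : R) (X : 'M[R]_(m, p)) (Y : 'M[R]_(m, n)).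
Hypothesis mu_gt0 : 0 < mu.

Local Notation d := (fun i => sing_val (col_proj X *m Y) i.+1).

(** Pythagoras: [Y - PY] is orthogonal to the column space of [X], which contains the columns of
    [PY - XB]. The first summand is constant in [B]. *)
Lemma rsc_criterionE (B : 'M[R]_(p, n)) :
  rsc_criterion mu X Y B = frobenius (Y - col_proj X *m Y) ^+ 2 +
    (frobenius (col_proj X *m Y - X *m B) ^+ 2 + mu * (\rank B)%:R).
Proof.
have [symP PX [Z PE]] := col_projP X.
move: (col_proj X) symP PX PE => Pi symPi PiX PiE.
have PiPi : Pi *m Pi = Pi by rewrite {2}PiE mulmxA PiX -PiE.
rewrite addrA /rsc_criterion -frobeniusD_orthogonal ?addrA ?subrK //.
have -> : Pi *m Y - X *m B = Pi *m (Pi *m Y - X *m B).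
  by rewrite mulmxBr !mulmxA PiPi PiX.
have YPi : (Y - Pi *m Y)^T *m Pi = 0.
  by rewrite -[X in _ *m X]symPi -trmx_mul mulmxBr mulmxA PiPi subrr trmx0.
by rewrite mulmxA YPi mul0mx.
Qed.

(** The indices passing the threshold form an initial segment because singular values decrease. Here
    [d i] is shifted, standing for [d_(i+1)(PY)]. *)
Lemma ltn_rsc_rank (i : nat) : (i < rsc_rank mu X Y)%N = (Num.sqrt mu <= d i).
Proof.
have sqrt_mu_gt0 : 0 < Num.sqrt mu by rewrite sqrtr_gt0.
apply/idP/idP => [|le_mu].
  apply: contraTT; rewrite -ltNge -leqNgt => lt_mu; apply/bigmax_leqP => k /andP[k_gt0].
  apply: contraTT; rewrite -ltnNge -ltNge => lt_ik; apply: le_lt_trans lt_mu.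
  by rewrite -(prednK k_gt0); apply: sing_val_decreasing; rewrite -ltnS prednK.
have lt_in : (i.+1 < n.+1)%N.
  rewrite ltnS ltnNge; apply/negP => le_ni.
  by move: le_mu; rewrite sing_val_default // leNgt sqrt_mu_gt0.
by apply: (@leq_bigmax_cond _ _ (fun k : 'I_n.+1 => k : nat) (Ordinal lt_in)).
Qed.

Lemma rsc_rank_le : (rsc_rank mu X Y <= n)%N.
Proof. by apply/bigmax_leqP => k _; rewrite -ltnS. Qed.

Lemma ltn_rsc_rank_sqr (i : nat) : (i < rsc_rank mu X Y)%N = (mu <= d i ^+ 2).
Proof.
rewrite ltn_rsc_rank -{2}[mu]sqr_sqrtr ?(ltW mu_gt0) //.
by rewrite ler_sqr ?nnegrE ?sqrtr_ge0 ?sing_val_ge0.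
Qed.

(** Spreads the penalty over the indices: each [i] pays either [mu] or [e i], so objectives can be
    compared term by term. *)
Lemma truncated_sumE (e : nat -> R) (k : nat) : (k <= n)%N ->
  \sum_(k <= i < n) e i + mu * k%:R = \sum_(0 <= i < n) (if (i < k)%N then mu else e i).
Proof.
move=> le_kn; rewrite addrC [RHS](big_cat_nat (n := k)) //=; congr (_ + _).
  transitivity (\sum_(0 <= i < k) mu); first by rewrite sumr_const_nat subn0 mulr_natr.
  by apply: eq_big_nat => i /andP[_ ->].
by apply: eq_big_nat => i /andP[le_ki _]; rewrite ltnNge le_ki.
Qed.

(** Thresholding at [mu] picks the smaller of [mu] and [d i ^+ 2] at every index. *)
Lemma rsc_rank_optimal (k : nat) : (k <= n)%N ->
  \sum_(rsc_rank mu X Y <= i < n) d i ^+ 2 + mu * (rsc_rank mu X Y)%:R <=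
  \sum_(k <= i < n) d i ^+ 2 + mu * k%:R.
Proof.
move=> le_kn; rewrite !truncated_sumE ?rsc_rank_le //; apply: ler_sum => i _.
have := ltn_rsc_rank_sqr i; case: (i < rsc_rank mu X Y)%N; case: (i < k)%N => //.
by move/esym/negbT; rewrite -ltNge => /ltW.
Qed.

Lemma exists_rsc_minimizer :
  exists2 B, rsc_minimizer mu X Y B & \rank B = rsc_rank mu X Y.
Proof.
have [symP PX [Z PE]] := col_projP X.
set K := rsc_rank mu X Y.
have [N rN NE] := eckart_young_attained (col_proj X *m Y) rsc_rank_le.
(* Writing the projection as [X *m Z] pulls the best approximation [PY *m N] back to a coefficient
   matrix. *)
pose B := Z *m Y *m N.
have XB : X *m B = col_proj X *m Y *m N by rewrite PE !mulmxA.
have rB : (\rank B <= K)%N by apply: leq_trans rN; exact: mxrankM_maxr.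
exists B => [B'|].
  rewrite !rsc_criterionE lerD2l XB NE.
  apply: (@le_trans _ _ (\sum_(K <= i < n) d i ^+ 2 + mu * K%:R)).
    by rewrite lerD2l ler_pM2l // ler_nat.
  apply: le_trans (rsc_rank_optimal (rank_leq_col B')) _.
  by rewrite lerD2r eckart_young // mxrankM_maxr.
(* Were the rank of [B] below [K], Eckart-Young at that rank would make the [d i ^+ 2] with
   [\rank B <= i < K] sum to at most 0, yet each is at least [mu]. *)
apply/eqP; rewrite eqn_leq rB leqNgt; apply/negP => lt_BK.
have := eckart_young (col_proj X *m Y) (mxrankM_maxr X B).
rewrite XB NE (big_cat_nat (n := K)) ?rsc_rank_le ?(ltnW lt_BK) //=.
rewrite gerDr big_ltn // leNgt ltr_pwDl ?sumr_ge0 // => [|i _]; last exact: sqr_ge0.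
by apply: lt_le_trans mu_gt0 _; rewrite -ltn_rsc_rank_sqr.
Qed.

(** Either [Ahat] is the minimizer just constructed, whose rank is known, or the minimizer is not
    unique and the tie-breaking rule applies. *)
Lemma rank_rsc_estimate (Ahat : 'M[R]_(p, n)) :
  rsc_estimate mu X Y Ahat -> \rank Ahat = rsc_rank mu X Y.
Proof.
move=> [_ tie]; have [B minB rB] := exists_rsc_minimizer.
by have [<-//|B_neq] := eqVneq B Ahat; apply: tie; exists B => //; exact/eqP.
Qed.

End RankSelection.

Lemma rsc_rank_eq (R : rcfType) (m p n : nat) (mu : R) (X : 'M[R]_(m, p))
    (Y : 'M[R]_(m, n)) (s : nat) : 0 < mu -> (0 < s)%N ->
  (rsc_rank mu X Y == s) =
  (Num.sqrt mu <= sing_val (col_proj X *m Y) s) &&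
  (sing_val (col_proj X *m Y) s.+1 < Num.sqrt mu).
Proof.
case: s => // s mu_gt0 _.
by rewrite -ltn_rsc_rank // ltNge -ltn_rsc_rank // -leqNgt andbC eqn_leq.
Qed.

(** * Measurability of singular values *)

Lemma frobenius_dense_rat (R : realType) (m n : nat) (C : 'M[R]_(m, n)) (e : R) :
  0 < e -> exists M : 'M[rat]_(m, n), frobenius (C - map_mx ratr M) < e.
Proof.
(* Entrywise error [a] gives squared error at most [N * a ^+ 2], below
   [e ^+ 2 = a ^+ 2 * (N + 1) ^+ 2]. The added 1 keeps this strict and covers empty matrices. *)
move=> e_gt0; pose N : R := (m * n)%:R; pose a := e / (N + 1).
have N_ge0 : 0 <= N by exact: ler0n.
have N1_gt0 : 0 < N + 1 by rewrite ltr_wpDl.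
have a_gt0 : 0 < a by rewrite divr_gt0.
have /choice[q qP] : forall ij : 'I_m * 'I_n,
    exists q : rat, `|C ij.1 ij.2 - ratr q| < a.
  move=> ij; have [|q] := @rat_in_itvoo _ (C ij.1 ij.2 - a) (C ij.1 ij.2 + a).
    by lra.
  by rewrite in_itv /= => /andP[q1 q2]; exists q; rewrite ltr_distlC q1 q2.
exists (\matrix_(i, j) q (i, j)).
rewrite -ltr_sqr ?nnegrE ?frobenius_ge0 ?(ltW e_gt0) // sqr_sqrtr; last first.
  by do 2!apply: sumr_ge0 => ? _; exact: sqr_ge0.
apply: (@le_lt_trans _ _ (N * a ^+ 2)).
  rewrite (_ : N * a ^+ 2 = \sum_(i < m) \sum_(j < n) a ^+ 2); last first.
    by rewrite !sumr_const !card_ord -mulrnA mulr_natl mulnC.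
  apply: ler_sum => i _; apply: ler_sum => j _; rewrite !mxE -real_normK ?num_real //.
  by rewrite ler_sqr ?nnegrE ?(ltW a_gt0) //; exact: ltW (qP (i, j)).
have eE : e = a * (N + 1) by rewrite divfK ?gt_eqF.
by clearbody a; rewrite eE exprMn [ltLHS]mulrC ltr_pM2l ?exprn_gt0 //; nra.
Qed.

Section SingValMeasurable.
Variables (d : measure_display) (T : measurableType d) (R : realType) (m n : nat).
Variable C : T -> 'M[R]_(m, n).
Hypothesis mC : forall i j, measurable_fun setT (fun w => C w i j).

Lemma measurable_frobenius_lt (M : 'M[R]_(m, n)) (t : R) :
  measurable [set w | frobenius (C w - M) < t].
Proof.
have mf : measurable_fun setT (fun w => frobenius (C w - M)).
  apply: (measurableT_comp (continuous_measurable_fun (@sqrt_continuous R))).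
  apply: measurable_sum => i; apply: measurable_sum => j; apply: measurable_funX.
  have -> : (fun w => (C w - M) i j) = (fun w => C w i j + - M i j).
    by apply/funext => w; rewrite !mxE.
  by apply: measurable_funD => //; exact: mC.
have := measurable_fun_ltr mf (measurable_cst t : measurable_fun setT (fun=> t)).
by move=> /(_ measurableT [set true] I); rewrite setTI.
Qed.

Lemma measurable_sing_val_lt (k : nat) (t : R) :
  measurable [set w | sing_val (C w) k < t].
Proof.
(* By Weyl's inequality sing_val is 1-Lipschitz, so rational matrices suffice
   to witness the strict inequality. *)
have -> : [set w | sing_val (C w) k < t] =
    \bigcup_(M : 'M[rat]_(m, n))
      [set w | frobenius (C w - map_mx ratr M) <
        t - sing_val (map_mx ratr M : 'M[R]_(m, n)) k].
  apply/seteqP; split=> w /=; last first.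
    move=> [M _ /=]; rewrite ltrBrDl; apply: le_lt_trans.
    exact: sing_val_frobenius.
  rewrite -subr_gt0 => gap_gt0.
  (* Half the gap suffices: moving from [C w] to [M] raises the singular value by less than the
     other half. *)
  have [M MP] := frobenius_dense_rat (C w) (divr_gt0 gap_gt0 (ltr0Sn R 1)).
  exists M; [exact: I|suff: frobenius (C w - map_mx ratr M) <
    t - sing_val (map_mx ratr M : 'M[R]_(m, n)) k by exact].
  have := sing_val_frobenius (map_mx ratr M) (C w) k.
  rewrite -[frobenius (_ - C w)]frobeniusN opprB; move: MP.
  by move: (frobenius _) (sing_val _ k) (sing_val _ k) => a b c; lra.
by apply: countable_bigcupT_measurable => // M; exact: measurable_frobenius_lt.
Qed.

Lemma measurable_sing_val_ge (k : nat) (t : R) :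
  measurable [set w | t <= sing_val (C w) k].
Proof.
have -> : [set w | t <= sing_val (C w) k] = ~` [set w | sing_val (C w) k < t].
  by apply/seteqP; split=> w /=; rewrite leNgt => /negP.
by apply: measurableC; exact: measurable_sing_val_lt.
Qed.

End SingValMeasurable.

Lemma measurable_mulmx_entry (d : measure_display) (T : measurableType d) (R : realType)
    (l m n : nat) (B : 'M[R]_(l, m)) (C : T -> 'M[R]_(m, n)) :
  (forall i j, measurable_fun setT (fun w => C w i j)) ->
  forall i j, measurable_fun setT (fun w => (B *m C w) i j).
Proof.
move=> mC i j.
have -> : (fun w => (B *m C w) i j) = (fun w => \sum_k B i k * C w k j).
  by apply/funext => w; rewrite mxE.
by apply: measurable_sum => k; apply: measurable_funM => //; exact: mC.
Qed.

(** * Probability of selecting the rank [s] *)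

Theorem theorem2 (R : realType) (d : measure_display) (T : measurableType d)
    (P : probability T R) (m p n : nat)
    (X : 'M[R]_(m, p)) (A : 'M[R]_(p, n))
    (E : 'I_m -> 'I_n -> {RV P >-> R}) (sigma : R)
    (E_indep : mutually_independent (fun ij : 'I_m * 'I_n => E ij.1 ij.2))
    (E_mean : forall i j, ('E_P[E i j] = 0)%E)
    (E_var : forall i j, ('V_P[E i j] = (sigma ^+ 2)%:E)%E)
    (Y : T -> 'M[R]_(m, n))
    (Y_model : forall w, Y w = X *m A + rv_matrix E w)
    (mu : R) (mu_gt0 : 0 < mu)
    (Ahat : T -> 'M[R]_(p, n))
    (Ahat_rsc : forall w, rsc_estimate mu X (Y w) (Ahat w))
    (s : nat) (s_ge1 : (1 <= s)%N) (s_le_r : (s <= \rank A)%N)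
    (delta : R) (delta_gt0 : 0 < delta) (delta_le1 : delta <= 1)
    (hs : (1 + delta) * Num.sqrt mu < sing_val (X *m A) s)
    (hs1 : sing_val (X *m A) s.+1 < (1 - delta) * Num.sqrt mu) :
  (1 - P [set w | (delta * Num.sqrt mu <= sing_val (col_proj X *m rv_matrix E w) 1)%R]
   <= P [set w | \rank (Ahat w) = s])%E.
Proof.
have mE i j : measurable_fun setT (fun w => rv_matrix E w i j).
  rewrite (_ : (fun w => _) = E i j); last by apply/funext => w; rewrite mxE.
  exact: measurable_funPT.
have mPE := measurable_mulmx_entry (col_proj X) mE.
have mY i j : measurable_fun setT (fun w => Y w i j).
  rewrite (_ : (fun w => _) = (fun w => (X *m A) i j + rv_matrix E w i j)).
    by apply: measurable_funD => //; exact: mE.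
  by apply/funext => w; rewrite Y_model mxE.
have mPY := measurable_mulmx_entry (col_proj X) mY.
have rankE : [set w | \rank (Ahat w) = s] =
    [set w | Num.sqrt mu <= sing_val (col_proj X *m Y w) s] `&`
    [set w | sing_val (col_proj X *m Y w) s.+1 < Num.sqrt mu].
  apply/seteqP; split=> w /=; rewrite (rank_rsc_estimate mu_gt0 (Ahat_rsc w)).
    by move/eqP; rewrite (rsc_rank_eq _ _ mu_gt0 s_ge1) => /andP.
  by move=> /andP; rewrite -(rsc_rank_eq _ _ mu_gt0 s_ge1) => /eqP.
have m_noise := measurable_sing_val_ge mPE 1 (delta * Num.sqrt mu).
(* The left side becomes the probability of the complementary event, so inclusion of measurable
   events suffices. *)
rewrite -probability_setC //; apply: le_measure; rewrite ?inE.
- exact: measurableC.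
- rewrite rankE; apply: measurableI.
    exact: measurable_sing_val_ge.
  exact: measurable_sing_val_lt.
have [_ PX _] := col_projP X.
rewrite rankE => w /= /negP; rewrite -ltNge => noise_lt.
have PYE : col_proj X *m Y w - X *m A = col_proj X *m rv_matrix E w.
  by rewrite Y_model mulmxDr mulmxA PX addrC addKr.
have := sing_val_lipschitz (X *m A) (col_proj X *m Y w) s.
have := sing_val_lipschitz (col_proj X *m Y w) (X *m A) s.+1.
rewrite -[X in _ -> (_ <= _ + X) -> _]sing_valN opprB PYE => le_s1 le_s.
(* The noise moves each singular value by less than [delta * Num.sqrt mu], exactly the margin left
   by [hs] above and [hs1] below the threshold. *)
move: hs hs1 noise_lt le_s le_s1.
move: (sing_val (X *m A) s) (sing_val (X *m A) s.+1) (sing_val _ 1) => a b c.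
by move: (sing_val _ s) (sing_val _ s.+1) => e f *; split; lra.
Qed.
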